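(* Let $G$ be a finite group with $Z(G)=1$, $H\subseteq G$ an abelian subgroup, $\omega$ a 2-cocycle on $\widehat H$, and $A=(kG)^J$ with $J=\sum_{\alpha,\beta\in\widehat H}\omega(\alpha,\beta)e_\alpha\otimes e_\beta$. Let $\pi:A\to kF$ be a quotient Hopf algebra with $F\cong\mathbb Z_p$, where $p$ is the least prime dividing $|G|$, and identify $\widehat F$ with a subgroup of $G(A^* )=\widehat G$ via $\mu\mapsto\mu\circ\pi$. Then $\pi$ is normal if and only if $\mu|_H$ is $\omega$-regular for all $\mu\in\widehat F$. If $\omega$ is non-degenerate, then $\pi$ is normal if and only if $\mu|_H=1$ for all $\mu\in\widehat F$.
   Context: $k$ is an algebraically closed field of characteristic zero. For a twist $J$ in a Hopf algebra $A$, $A^J$ is the Hopf algebra with the same algebra and counit, comultiplication $\Delta^J(h)=J^{-1}\Delta(h)J$ and twisted antipode. For an abelian subgroup $H$ of $G$, $\widehat H$ is its character group, $e_\chi=\frac{1}{|H|}\sum_{h\in H}\chi(h^{-1})h$, and for a 2-cocycle $\omega$ on $\widehat H$, $J=\sum\omega(\alpha,\beta)e_\alpha\otimes e_\beta$ is a twist in $kG$. $\chi\in\widehat H$ is $\omega$-regular if $\omega(\chi,\psi)=\omega(\psi,\chi)$ for all $\psi\in\widehat H$; $\omega$ is non-degenerate if only the trivial character is $\omega$-regular. A Hopf subalgebra is normal if stable under the adjoint action ${}^hx=\sum h_1xS(h_2)$. A quotient Hopf algebra map $\pi:A\to B$ is called normal (conormal) if $\pi^*(B^* )$ is a normal Hopf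 subalgebra of $A^*$, equivalently $B\cong A/AK^+$ with $K=\{a:(\mathrm{id}\otimes\pi)\Delta(a)=a\otimes 1\}$ a normal Hopf subalgebra of $A$. *)

(* Defs.v *)
From HB Require Import structures.
From mathcomp Require Import all_boot all_order all_algebra all_fingroup all_solvable.
Set Implicit Arguments. Unset Strict Implicit. Unset Printing Implicit Defensive.
Import GRing.Theory.
Local Open Scope ring_scope.

(* Concrete model of the Hopf algebras in the paper.
   * An element of kG (G = the whole finite group gT) is its coefficient
     function  a : {ffun gT -> k},  a = \sum_g a(g) g.
   * An element of kG (x) kG is a coefficient function on gT * gT.
   * An element of the dual (kG)^* is its function of values on the basis
     g in G, again  {ffun gT -> k}.
   * A character of the abelian subgroup H (an element of \hat H) is a
     function {ffun gT -> k} that is multiplicative on H, sends 1 to 1 and is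
     0 outside H (canonical representative). *)

Section HopfModel.
Variables (k : fieldType) (gT : finGroupType).

Definition delta (g : gT) : {ffun gT -> k} := [ffun x => (x == g)%:R].

Definition gmul (a b : {ffun gT -> k}) : {ffun gT -> k} :=
  [ffun g => \sum_(x : gT) a x * b (x^-1 * g)%g].

Definition gmul2 (X Y : {ffun gT * gT -> k}) : {ffun gT * gT -> k} :=
  [ffun q => \sum_(x : gT) \sum_(y : gT) X (x, y) * Y ((x^-1 * q.1)%g, (y^-1 * q.2)%g)].

Definition gcomul (h : {ffun gT -> k}) : {ffun gT * gT -> k} :=
  [ffun q => if q.1 == q.2 then h q.1 else 0].

Variable H : {group gT}.

Definition is_charH (f : {ffun gT -> k}) : Prop :=
  [/\ f 1%g = 1,
      (forall x, x \notin H -> f x = 0) &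
      (forall x y, x \in H -> y \in H -> f (x * y)%g = f x * f y)].

Definition char_enum (s : seq {ffun gT -> k}) : Prop :=
  uniq s /\ (forall f, f \in s <-> is_charH f).

Definition resH (f : gT -> k) : {ffun gT -> k} :=
  [ffun g => if g \in H then f g else 0].
Definition chartriv : {ffun gT -> k} := resH (fun _ => 1).

Definition cmul (a b : {ffun gT -> k}) : {ffun gT -> k} := [ffun g => a g * b g].

Definition e_chi (chi : {ffun gT -> k}) : {ffun gT -> k} :=
  [ffun g => if g \in H then (#|H|%:R)^-1 * chi (g^-1)%g else 0].

Variable s : seq {ffun gT -> k}.
Variable om : {ffun gT -> k} -> {ffun gT -> k} -> k.

Definition omega_cocycle : Prop :=
  [/\ (forall a b, a \in s -> b \in s -> om a b != 0),
      (forall a, a \in s -> om chartriv a = 1 /\ om a chartriv = 1) &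
      (forall a b c, a \in s -> b \in s -> c \in s ->
          om a b * om (cmul a b) c = om b c * om a (cmul b c))].

Definition omega_regular (chi : {ffun gT -> k}) : Prop :=
  forall psi, psi \in s -> om chi psi = om psi chi.

Definition omega_nondegenerate : Prop :=
  forall chi, chi \in s -> omega_regular chi -> chi = chartriv.

Definition twistJ : {ffun gT * gT -> k} :=
  [ffun q => \sum_(a <- s) \sum_(b <- s) om a b * e_chi a q.1 * e_chi b q.2].
Definition twistJinv : {ffun gT * gT -> k} :=
  [ffun q => \sum_(a <- s) \sum_(b <- s) (om a b)^-1 * e_chi a q.1 * e_chi b q.2].

Definition twcomul (h : {ffun gT -> k}) : {ffun gT * gT -> k} :=
  gmul2 twistJinv (gmul2 (gcomul h) twistJ).

(* Dual Hopf algebra A^*: product dual to Delta^J, unit = counit of A,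
   coproduct dual to the product of kG: Delta(f)(a,b) = f(ab),
   counit f |-> f(1). *)
Definition dmul (f phi : {ffun gT -> k}) : {ffun gT -> k} :=
  [ffun g => \sum_(a : gT) \sum_(b : gT) twcomul (delta g) (a, b) * f a * phi b].
Definition dunit : {ffun gT -> k} := [ffun => 1].

(* A linear map T : A^* -> A^* given by its values t a = T(delta_a);
   T(f) = sum_a f(a) t(a). It is the antipode of A^* iff
   m (T (x) id) Delta = 1 eps = m (id (x) T) Delta. *)
Definition dlin (t : gT -> {ffun gT -> k}) (f : {ffun gT -> k}) : {ffun gT -> k} :=
  [ffun g => \sum_(a : gT) f a * t a g].
Definition is_dual_antipode (t : gT -> {ffun gT -> k}) : Prop :=
  forall f : {ffun gT -> k},
    [ffun g => \sum_(a : gT) \sum_(b : gT) f (a * b)%g * dmul (t a) (delta b) g]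
      = [ffun g => f 1%g * dunit g] /\
    [ffun g => \sum_(a : gT) \sum_(b : gT) f (a * b)%g * dmul (delta a) (t b) g]
      = [ffun g => f 1%g * dunit g].

(* left adjoint action of A^* on itself: f . x = sum f_1 x S (f_2) *)
Definition dad (t : gT -> {ffun gT -> k}) (f x : {ffun gT -> k}) : {ffun gT -> k} :=
  [ffun g => \sum_(a : gT) \sum_(b : gT) f (a * b)%g * dmul (dmul (delta a) x) (t b) g].

Variable fT : finGroupType.

Definition fmul (a b : {ffun fT -> k}) : {ffun fT -> k} :=
  [ffun g => \sum_(x : fT) a x * b (x^-1 * g)%g].
Definition fone : {ffun fT -> k} := [ffun x => (x == 1%g)%:R].

(* pi : A -> kF, given on the basis: pi(g) = pig g; pi(a) = sum_g a(g) pig(g) *)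
Variable pig : gT -> {ffun fT -> k}.

Definition quotient_hopf_map : Prop :=
  [/\ pig 1%g = fone,
      (forall g h, pig (g * h)%g = fmul (pig g) (pig h)),
      (forall g, \sum_(u : fT) pig g u = 1),
      (forall g u v, \sum_(a : gT) \sum_(b : gT) twcomul (delta g) (a, b) * pig a u * pig b v
                     = if u == v then pig g u else 0) &
      (forall y : {ffun fT -> k}, exists c : {ffun gT -> k},
          forall u, y u = \sum_(g : gT) c g * pig g u)].

Definition pi_dual_image (x : {ffun gT -> k}) : Prop :=
  exists phi : {ffun fT -> k}, forall g, x g = \sum_(u : fT) phi u * pig g u.

Definition normal_quotient : Prop :=
  forall t, is_dual_antipode t ->
    forall f x, pi_dual_image x -> pi_dual_image (dad t f x).

Definition is_fchar (mu : {ffun fT -> k}) : Prop :=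
  mu 1%g = 1 /\ forall x y, mu (x * y)%g = mu x * mu y.

Definition mu_pi (mu : {ffun fT -> k}) : gT -> k :=
  fun g => \sum_(u : fT) mu u * pig g u.

End HopfModel.

(* Main.v *)
Require Import Defs.
From HB Require Import structures.
From mathcomp Require Import all_boot all_order all_algebra all_fingroup all_solvable.
From mathcomp Require Import all_field all_character.
From mathcomp Require Import ring.
Set Implicit Arguments. Unset Strict Implicit. Unset Printing Implicit Defensive.
Import GRing.Theory.
Local Open Scope ring_scope.

(* The dual of (kG)^J is the algebra of functions on G, bigraded by pairs of
   characters of H (left and right translation by H), with the pointwise
   product rescaled by om(a, c)^-1 om(b, d) on bidegrees (a, b), (c, d).

   A quotient onto kF with F abelian comes from a surjection f : G -> F. For
   chi = mu o f, the character b |-> om(chi, b) / om(b, chi) of the dual of H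
   is evaluation at some u in H, and phi * chi = chi * (phi o conj_u).
   Substituting this in the adjoint action gives
     phi . chi = chi * (g |-> Psi(phi)([u, g])),  with Psi invertible,
   so pi is normal iff every such u centralizes N = ker f. Now u has order 1
   or p. If it were p, then p would divide the order of the centralizer of N, a
   normal subgroup of G, and a Sylow p-subgroup P of G would have a nontrivial
   central element centralizing N; as G = N P, that element would be central
   in G. Hence u = 1, i.e. chi is om-regular on H. *)

(** * Characters of a finite abelian group *)

Section Characters.
Variables (k : fieldType) (gT : finGroupType) (H : {group gT}).
Implicit Types (a b f : {ffun gT -> k}) (s : seq {ffun gT -> k}).

(** The pairing of kH with the span of [s] has no kernel on the kH side. In this form the existence
    of enough characters can be carried along over any field. *)
Definition separates s : Prop :=
  forall x : gT -> k, (forall a, a \in s -> \sum_(h in H) x h * a h = 0) ->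
  forall h, h \in H -> x h = 0.

Lemma charH_mulV a x : is_charH H a -> x \in H -> a x * a x^-1%g = 1.
Proof. by case=> a1 _ aM Hx; rewrite -aM ?groupV // mulgV. Qed.

Lemma charH_neq0 a x : is_charH H a -> x \in H -> a x != 0.
Proof.
move=> ca Hx; apply/eqP=> a0; have := charH_mulV ca Hx.
by rewrite a0 mul0r => /esym/eqP; rewrite oner_eq0.
Qed.

Lemma charH_cmul a b : is_charH H a -> is_charH H b -> is_charH H (cmul a b).
Proof.
move=> [a1 a0 aM] [b1 b0 bM]; split=> [|x Hx|x y Hx Hy]; rewrite !ffunE.
- by rewrite a1 b1 mulr1.
- by rewrite a0 // mul0r.
- by rewrite aM // bM // mulrACA.
Qed.

Definition cinv a : {ffun gT -> k} := [ffun g => a g^-1%g].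

Lemma charH_cinv a : is_charH H a -> is_charH H (cinv a).
Proof.
move=> [a1 a0 aM]; split=> [|x Hx|x y Hx Hy]; rewrite !ffunE.
- by rewrite invg1.
- by rewrite a0 // groupV.
- by rewrite invMg aM ?groupV // mulrC.
Qed.

Lemma charH_triv : is_charH H (chartriv k H).
Proof.
split=> [|x Hx|x y Hx Hy]; rewrite !ffunE ?group1 ?groupM ?Hx ?Hy ?mulr1 //.
by rewrite (negPf Hx).
Qed.

Lemma cmulC a b : cmul a b = cmul b a.
Proof. by apply/ffunP=> g; rewrite !ffunE mulrC. Qed.

Lemma cmul_cinv a : is_charH H a -> cmul (cinv a) a = chartriv k H.
Proof.
move=> ca; apply/ffunP=> g; rewrite !ffunE mulrC.
have [Hg|] := boolP (g \in H); first exact: charH_mulV.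
by case: ca => _ a0 _ /a0->; rewrite mul0r.
Qed.

Lemma charH_eqP a b : is_charH H a -> is_charH H b ->
  (forall h, h \in H -> a h = b h) -> a = b.
Proof.
move=> [_ a0 _] [_ b0 _] ab; apply/ffunP=> g.
by have [/ab//|Hg] := boolP (g \in H); rewrite a0 ?b0.
Qed.

Lemma charH_orthogonality a b : is_charH H a -> is_charH H b ->
  \sum_(h in H) a h^-1%g * b h = if a == b then #|H|%:R else 0.
Proof.
move=> ca cb; have [<-|nab] := eqVneq a b.
  rewrite (eq_bigr (fun=> 1)) ?sumr_const // => h Hh.
  by rewrite mulrC charH_mulV.
apply/eqP; apply: contraNT nab => nz; apply/eqP/charH_eqP => // h Hh.
(* Translating the summation variable by [h] multiplies [S] by [a h^-1 * b h], so a nonzero [S]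
   forces [a h = b h]. *)
set S := \sum_(x in H) _ in nz; suff: S = S * (a h^-1%g * b h).
  rewrite -{1}[S]mulr1 => /(mulfI nz) E.
  by rewrite -[LHS]mulr1 E mulrA charH_mulV // mul1r.
rewrite {1}/S (reindex_inj (mulIg h)) /= mulr_suml.
rewrite (eq_bigl [in H]) => [|x]; last by rewrite groupMr.
apply: eq_bigr => x Hx.
case: ca cb => [_ _ aM] [_ _ bM]; rewrite invMg aM ?groupV // bM //.
ring.
Qed.

Lemma sum_e_chi a b : #|H|%:R != 0 :> k -> is_charH H a -> is_charH H b ->
  \sum_h e_chi H a h * b h = (a == b)%:R.
Proof.
move=> nz ca cb; rewrite (bigID (mem H)) /= [X in _ + X]big1 ?addr0; last first.
  by move=> h /negPf Hh; rewrite ffunE Hh mul0r.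
rewrite (eq_bigr (fun h => #|H|%:R^-1 * (a h^-1%g * b h))); last first.
  by move=> h Hh; rewrite ffunE Hh mulrA.
rewrite -mulr_sumr charH_orthogonality //.
by case: eqP => _; rewrite ?mulVf ?mulr0.
Qed.

Lemma e_chi_out a h : h \notin H -> e_chi H a h = 0.
Proof. by move=> /negPf Hh; rewrite ffunE Hh. Qed.

Lemma e_chi_conv a b h : #|H|%:R != 0 :> k -> is_charH H a -> is_charH H b ->
  \sum_x e_chi H a x * e_chi H b (x^-1 * h)%g = (a == b)%:R * e_chi H a h.
Proof.
move=> nz ca cb; have [Hh|nHh] := boolP (h \in H); last first.
  rewrite [e_chi H a h]e_chi_out // mulr0 big1 // => x _.
  have [Hx|/e_chi_out->] := boolP (x \in H); last by rewrite mul0r.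
  by rewrite [e_chi H b _]e_chi_out ?mulr0 // groupMl ?groupV.
rewrite (eq_bigr (fun x => e_chi H a x * b x * (#|H|%:R^-1 * b h^-1%g))); last first.
  move=> x _; have [Hx|/e_chi_out->] := boolP (x \in H); last by rewrite !mul0r.
  rewrite !ffunE Hx groupM ?groupV //; case: cb => _ _ bM.
  by rewrite invMg invgK bM ?groupV //; ring.
rewrite -mulr_suml sum_e_chi //; have [->|_] := eqVneq a b.
  by rewrite ffunE Hh.
by rewrite !mul0r.
Qed.

(** The two sides pair equally with every [b] in [s], because [e_a] pairs to 1 with [a] and to 0
    with the other characters; separation kills the difference. *)
Lemma sum_separating_e_chi s : #|H|%:R != 0 :> k ->
  uniq s -> (forall a, a \in s -> is_charH H a) -> separates s ->
  forall h, \sum_(a <- s) e_chi H a h = (h == 1%g)%:R.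
Proof.
move=> nz us cs sep h; have [Hh|nHh] := boolP (h \in H); last first.
  rewrite big1 => [|a _]; last exact: e_chi_out.
  by case: eqP => // h1; rewrite h1 group1 in nHh.
apply/eqP; rewrite -subr_eq0; apply/eqP; move: h Hh.
apply: sep => b bs; have cb := cs b bs.
under eq_bigr do rewrite mulrBl; rewrite sumrB.
have -> : \sum_(h in H) (h == 1%g)%:R * b h = 1.
  rewrite (bigD1 1%g) //= eqxx mul1r big1 ?addr0; first by case: cb.
  by move=> h /andP[_ /negPf->]; rewrite mul0r.
under eq_bigr do rewrite mulr_suml; rewrite exchange_big /=.
rewrite (eq_big_seq (fun a => (a == b)%:R)) => [|a /cs ca]; last first.
  rewrite -(sum_e_chi nz ca cb) [RHS](bigID (mem H)) /=.
  by rewrite [X in _ + X]big1 ?addr0 // => h Hh; rewrite e_chi_out ?mul0r.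
rewrite (bigD1_seq b) //= eqxx big1 ?addr0 => [|a /negPf-> //].
by rewrite subrr.
Qed.

End Characters.

(** * Enough characters, by diagonalizing the regular representation *)

Lemma diagonalizable_finite_order (k : closedFieldType) n (A : 'M[k]_n.+1) m :
  m%:R != 0 :> k -> A ^+ m = 1 -> diagonalizable A.
Proof.
move=> m0 Am; have [r Dr] := closed_field_poly_normal ('X^m - 1 : {poly k}).
have m_gt0 : (0 < m)%N by case: m m0 {Am Dr} => //; rewrite eqxx.
have lc : lead_coef ('X^m - 1 : {poly k}) = 1.
  by apply/eqP; rewrite -[_ == _]/('X^m - 1 \is monic) monicXnsubC.
rewrite lc scale1r in Dr.
apply/diagonalizableP; exists r.
  by rewrite -separable_prod_XsubC -Dr; apply: separable_Xn_sub_1.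
rewrite -Dr; apply/mxminpoly_minP; rewrite rmorphB rmorph1 rmorphXn /=.
by rewrite horner_mx_X Am subrr.
Qed.

Lemma diagonalizable_repr (k : closedFieldType) (gT : finGroupType)
    (G : {group gT}) n (rG : mx_representation k G n) x :
  [pchar k] =i pred0 -> x \in G -> diagonalizable (rG x).
Proof.
move=> ch0 Gx; case: n rG => [|n] rG.
  by rewrite (flatmx0 (rG x)); apply: diagonalizable0.
apply: (@diagonalizable_finite_order _ _ _ #[x]%g).
  by rewrite ((pcharf0P k).1 ch0) -lt0n order_gt0.
by rewrite -repr_mxX // expg_order repr_mx1.
Qed.

(** The operators of the regular representation commute and have finite order, hence are
    simultaneously diagonalizable. Each diagonal entry is a character, and separation follows from
    the linear independence of the operators. *)
Lemma character_separation (k : closedFieldType) (gT : finGroupType)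
    (H : {group gT}) :
  [pchar k] =i pred0 -> abelian H ->
  exists s : seq {ffun gT -> k},
    [/\ uniq s, forall a, a \in s -> is_charH H a & separates H s].
Proof.
move=> ch0 abH.
pose rH := regular_repr k H.
pose As := [seq rH h | h in H].
have [P uP /allP dP] : codiagonalizable As.
  apply/codiagonalizableP; split=> [_ _ /imageP[x Hx ->] /imageP[y Hy ->]|].
    by rewrite /comm_mx -!repr_mxM // (centsP abH x Hx y Hy).
  by move=> _ /imageP[x Hx ->]; apply: diagonalizable_repr.
pose D h := P *m rH h *m invmx P.
have DD h : h \in H -> is_diag_mx (D h).
  by move=> Hh; rewrite /D -conjumx //; apply/dP/imageP; exists h.
have D1 : D 1%g = 1%:M by rewrite /D repr_mx1 mulmx1 mulmxV.
have DM x y : x \in H -> y \in H -> D (x * y)%g = D x *m D y.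
  by move=> Hx Hy; rewrite /D repr_mxM // !mulmxA mulmxKV.
pose c i : {ffun gT -> k} := [ffun h => if h \in H then D h i i else 0].
exists (undup [seq c i | i <- enum 'I_(gcard H)]); split.
- exact: undup_uniq.
- move=> a; rewrite mem_undup => /mapP[i _ ->]; split.
  + by rewrite ffunE group1 D1 mxE eqxx.
  + by move=> x /negPf Hx; rewrite ffunE Hx.
  move=> x y Hx Hy; rewrite !ffunE Hx Hy groupM // DM // mxE (bigD1 i) //=.
  rewrite big1 ?addr0 // => j ij.
  by have /is_diag_mxP-> := DD x Hx; rewrite ?mul0r // eq_sym.
move=> x xc.
have : \sum_(h in H) x h *: D h = 0.
  apply/matrixP=> i j; rewrite summxE mxE.
  have [<-|ij] := eqVneq i j; last first.
    apply: big1 => h Hh; rewrite mxE.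
    by have /is_diag_mxP-> := DD h Hh; rewrite ?mulr0.
  rewrite -[RHS](xc (c i)); last by rewrite mem_undup map_f // mem_enum.
  by apply: eq_bigr => h Hh; rewrite mxE ffunE Hh.
move/(congr1 (fun M => invmx P *m M *m P)); rewrite mulmx0 mul0mx.
rewrite mulmx_sumr mulmx_suml => Dx h Hh.
have {Dx}: \sum_(h in H) x h *: rH h = 0.
  rewrite -[RHS]Dx; apply: eq_bigr => g Hg.
  by rewrite -scalemxAr -scalemxAl /D !mulmxA mulVmx // mul1mx mulmxKV.
(* [gring_proj h] reads off the coefficient of [rH h] in a combination of the [rH g]. *)
move/(congr1 (fun M => gring_proj h M 0 0)).
have E (a : k) g : g \in H -> gring_proj h (a *: rH g) = a *: (h == g)%:R.
  by move=> Hg; rewrite linearZ; congr (_ *: _); apply: gring_projE.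
rewrite linear_sum linear0 summxE mxE (bigD1 h) //= big1 ?addr0.
  by rewrite E // eqxx !mxE mulr1.
move=> g /andP[Hg gh].
by rewrite E // eq_sym (negPf gh) !mxE mulr0.
Qed.

(** * The bigraded dual algebra *)

Section Bigrading.
Variables (k : fieldType) (gT : finGroupType) (H : {group gT}).
Variable s : seq {ffun gT -> k}.
Hypothesis nzH : #|H|%:R != 0 :> k.
Hypothesis uniq_s : uniq s.
Hypothesis mem_s : forall a, a \in s <-> is_charH H a.
Hypothesis sep_s : separates H s.
Implicit Types (a b c d : {ffun gT -> k}) (f phi psi : {ffun gT -> k}).

Let cs a : a \in s -> is_charH H a. Proof. exact: (mem_s a).1. Qed.
Let e_sum := sum_separating_e_chi nzH uniq_s cs sep_s.

Definition bihomogeneous a b (f : gT -> k) := forall x y g,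
  x \in H -> y \in H -> f (x * g * y)%g = a x * b y * f g.

(** The idempotents of [a] and [b] acting by left and right translation. The argument is a plain
    function, so that a function of two variables can be projected in one of them. *)
Definition bproj a b (f : gT -> k) : {ffun gT -> k} :=
  [ffun g => \sum_x \sum_y e_chi H a x * e_chi H b y * f (x * g * y)%g].

Lemma e_chi_mul a x y : is_charH H a -> x \in H ->
  e_chi H a (x * y)%g = a x^-1%g * e_chi H a y.
Proof.
move=> [_ _ aM] Hx; rewrite !ffunE groupMl //.
have [Hy|_] := boolP (y \in H); last by rewrite mulr0.
by rewrite invMg aM ?groupV //; ring.
Qed.

Lemma e_chiC a x y : abelian H -> x \in H ->
  e_chi H a (x * y)%g = e_chi H a (y * x)%g.
Proof.
move=> abH Hx; have [Hy|nHy] := boolP (y \in H).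
  by rewrite (centsP abH x Hx y Hy).
by rewrite !ffunE groupMl // groupMr // (negPf nHy).
Qed.

Lemma bproj_bihomogeneous a b f : abelian H -> a \in s -> b \in s ->
  bihomogeneous a b (bproj a b f).
Proof.
move=> abH sa sb u v g Hu Hv; rewrite !ffunE.
rewrite (reindex_inj (mulIg u^-1%g)) /= mulr_sumr; apply: eq_bigr => x _.
rewrite (reindex_inj (mulgI v^-1%g)) /= mulr_sumr; apply: eq_bigr => y _.
have ca := cs sa; have cb := cs sb.
rewrite -(e_chiC _ _ abH) ?groupV // !e_chi_mul ?groupV // !invgK.
have -> : (x * u^-1 * (u * g * v) * (v^-1 * y) = x * g * y)%g.
  by rewrite !mulgA !(mulgKV, mulgK).
by ring.
Qed.

Lemma bproj_of_bihomogeneous a b c d f :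
  a \in s -> b \in s -> c \in s -> d \in s -> bihomogeneous a b f ->
  bproj c d f = if (c == a) && (d == b) then f else 0.
Proof.
move=> /cs ca /cs cb /cs cc /cs cd hf; apply/ffunP=> g; rewrite ffunE.
transitivity (\sum_x \sum_y e_chi H c x * a x * (e_chi H d y * b y) * f g).
  apply: eq_bigr => x _; apply: eq_bigr => y _.
  have [Hx|/e_chi_out->] := boolP (x \in H); last by rewrite !mul0r.
  have [Hy|/e_chi_out->] := boolP (y \in H); last by rewrite !(mul0r, mulr0).
  by rewrite hf //; ring.
under eq_bigr do rewrite -mulr_suml -mulr_sumr.
rewrite -!mulr_suml !sum_e_chi //.
by case: eqP => _; case: eqP => _; rewrite ?ffunE /= ?mul0r ?mulr0
  ?mul0r ?mulr1 ?mul1r.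
Qed.

Definition bichars := [seq (a, b) | a <- s, b <- s].

Lemma mem_bichars p : p \in bichars -> p.1 \in s /\ p.2 \in s.
Proof. by case/allpairsP=> q [? ? ->]. Qed.

Lemma sum_e_chi_fun (G : gT -> k) : \sum_(a <- s) \sum_x e_chi H a x * G x = G 1%g.
Proof.
rewrite exchange_big /= (bigD1 1%g) //= -mulr_suml e_sum eqxx mul1r.
rewrite big1 ?addr0 // => x /negPf x1.
by rewrite -mulr_suml e_sum x1 mul0r.
Qed.

Lemma sum_bproj (f : gT -> k) g : \sum_(p <- bichars) bproj p.1 p.2 f g = f g.
Proof.
rewrite big_allpairs_dep /=.
under eq_bigr => a _.
  under eq_bigr => b _.
    rewrite ffunE; under eq_bigr => x _.
      under eq_bigr do rewrite -mulrA; rewrite -mulr_sumr; over.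
    over.
  rewrite exchange_big /=.
  under eq_bigr => x _ do rewrite -mulr_sumr (sum_e_chi_fun (fun y => f (x * g * y)%g)).
  over.
by rewrite (sum_e_chi_fun (fun x => f (x * g * 1)%g)) mul1g mulg1.
Qed.

Lemma bigraded_decomposition f : f = \sum_(p <- bichars) bproj p.1 p.2 f.
Proof. by apply/ffunP=> g; rewrite sum_ffunE sum_bproj. Qed.

(** Reduces linear identities to bihomogeneous functions, on which the twisted product is pointwise
    up to a scalar. *)
Lemma bigraded_ind (Q : {ffun gT -> k} -> Prop) : abelian H ->
  Q 0 -> (forall f phi, Q f -> Q phi -> Q (f + phi)) ->
  (forall a b f, a \in s -> b \in s -> bihomogeneous a b f -> Q f) ->
  forall f, Q f.
Proof.
move=> abH Q0 QD Qh f; rewrite [f]bigraded_decomposition.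
rewrite big_seq; elim/big_ind: _ => // p /mem_bichars[pa pb].
exact: Qh pa pb (bproj_bihomogeneous _ abH pa pb).
Qed.

Lemma sum_bproj_delta a b (F : gT -> k) g :
  \sum_z F z * bproj a b (delta k z) g = bproj a b F g.
Proof.
rewrite ffunE; under eq_bigr do rewrite ffunE mulr_sumr.
rewrite exchange_big /=; apply: eq_bigr => x _.
under eq_bigr do rewrite mulr_sumr.
rewrite exchange_big /=; apply: eq_bigr => y _.
rewrite (bigD1 (x * g * y)%g) //= [delta _ _ _]ffunE eqxx mulr1 mulrC.
rewrite big1 ?addr0 // => z.
by rewrite [delta _ _ _]ffunE eq_sym => /negPf->; rewrite !mulr0.
Qed.

Lemma e_chi_conv_fun a b (G : gT -> k) : a \in s -> b \in s ->
  \sum_x \sum_y e_chi H a x * e_chi H b y * G (x * y)%g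
    = (a == b)%:R * \sum_h e_chi H a h * G h.
Proof.
move=> /cs ca /cs cb.
under eq_bigr => x _ do rewrite (reindex_inj (mulgI x^-1%g)) /=.
rewrite exchange_big mulr_sumr; apply: eq_bigr => h _ /=.
under eq_bigr do rewrite mulKVg.
by rewrite -mulr_suml e_chi_conv // mulrA.
Qed.

(* If [F (a h) b = F a (h b)], the right degree in the first variable must be
   the left degree in the second one, and summing over it is evaluation at 1. *)
Lemma bproj_contract (C : {ffun gT -> k} * {ffun gT -> k} ->
      {ffun gT -> k} * {ffun gT -> k} -> k)
    (c : {ffun gT -> k} -> {ffun gT -> k} -> k) (F : gT -> gT -> k) g h :
  (forall x y z, z \in H -> F (x * z)%g y = F x (z * y)%g) ->
  (forall a b d, a \in s -> b \in s -> d \in s -> C (a, b) (b, d) = c a d) ->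
  \sum_(p <- bichars) \sum_(q <- bichars)
     C p q * bproj p.1 p.2 (fun x => bproj q.1 q.2 (F x) h) g
  = \sum_(a <- s) \sum_(d <- s) c a d *
      \sum_x \sum_y e_chi H a x * e_chi H d y * F (x * g)%g (h * y)%g.
Proof.
move=> FH Cc.
pose G a d z := \sum_x \sum_y
  e_chi H a x * e_chi H d y * F (x * g)%g (z * (h * y))%g.
(* The hypothesis on [F] merges the right translation of the first variable and the left translation
   of the second into one product; convolving the idempotents of [b] and [b'] then forces
   [b = b']. *)
have E a b b' d : a \in s -> b \in s -> b' \in s -> d \in s ->
    bproj a b (fun x => bproj b' d (F x) h) g
      = (b == b')%:R * \sum_z e_chi H b z * G a d z.
  move=> sa sb sb' sd; rewrite -e_chi_conv_fun // ffunE exchange_big /=.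
  apply: eq_bigr => x' _.
  transitivity (\sum_x \sum_y \sum_y' e_chi H a x * e_chi H b x' *
     (e_chi H b' y * e_chi H d y' * F (x * g)%g (x' * y * (h * y'))%g)).
    apply: eq_bigr => x _; rewrite [bproj _ _ _ _]ffunE mulr_sumr.
    apply: eq_bigr => y _.
    rewrite mulr_sumr; apply: eq_bigr => y' _.
    have [Hx|/e_chi_out->] := boolP (x' \in H); last by rewrite !(mulr0, mul0r).
    by rewrite FH // !mulgA.
  rewrite exchange_big /=; apply: eq_bigr => y _; rewrite /G mulr_sumr.
  apply: eq_bigr => x _; rewrite mulr_sumr; apply: eq_bigr => y' _.
  by ring.
rewrite big_allpairs_dep /=; apply: eq_big_seq => a sa.
rewrite (eq_big_seq (fun b => \sum_(d <- s) c a d * \sum_z e_chi H b z * G a d z)).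
  rewrite exchange_big /=; apply: eq_bigr => d _; rewrite -mulr_sumr.
  rewrite (sum_e_chi_fun (G a d)); congr (_ * _).
  by apply: eq_bigr => x _; apply: eq_bigr => y _; rewrite mul1g.
move=> b sb; rewrite big_allpairs_dep /= (bigD1_seq b) //= [X in _ + X]big1_seq ?addr0.
  by apply: eq_big_seq => d sd; rewrite E // Cc // eqxx mul1r.
move=> b' /andP[b'b sb']; rewrite big1_seq // => d /andP[_ sd].
by rewrite E // eq_sym (negPf b'b) mul0r mulr0.
Qed.

(** At the identity, left and right translation by [h] agree, so a component of bidegree [(a, d)]
    with [a != d] vanishes there. *)
Lemma sum_bproj1 (c : {ffun gT -> k} -> {ffun gT -> k} -> k) f : abelian H ->
  (forall a, a \in s -> c a a = 1) ->
  \sum_(a <- s) \sum_(d <- s) c a d * bproj a d f 1%g = f 1%g.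
Proof.
move=> abH c1; rewrite -[RHS]sum_bproj big_allpairs_dep /=.
apply: eq_big_seq => a sa; apply: eq_big_seq => d sd.
have [<-|ad] := eqVneq a d; first by rewrite c1 ?mul1r.
have hf := bproj_bihomogeneous f abH sa sd.
suff -> : bproj a d f 1%g = 0 by rewrite mulr0.
apply: contraNeq ad => nz; apply/eqP/charH_eqP; [exact: cs|exact: cs|].
move=> h Hh; have := hf h 1%g 1%g Hh (group1 H); have := hf 1%g h 1%g (group1 H) Hh.
case: (cs sa) (cs sd) => [a1 _ _] [d1 _ _].
rewrite a1 d1 !mulg1 !mul1g !(mulr1, mul1r) => -> /esym.
exact: mulIf.
Qed.

(** * The twisted product: bidegrees, associativity and unit *)

Variable om : {ffun gT -> k} -> {ffun gT -> k} -> k.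
Hypothesis coc : omega_cocycle H s om.
Hypothesis abH : abelian H.

Local Notation triv := (chartriv k H).
Local Notation "f ** g" := (dmul H s om f g) (at level 40, left associativity).

Lemma mem_cmul a b : a \in s -> b \in s -> cmul a b \in s.
Proof. by move=> /cs ca /cs cb; apply/mem_s/charH_cmul. Qed.

Lemma mem_cinv a : a \in s -> cinv a \in s.
Proof. by move=> /cs ca; apply/mem_s/charH_cinv. Qed.

Lemma mem_triv : triv \in s.
Proof. exact/mem_s/charH_triv. Qed.

Lemma cocycle_neq0 a b : a \in s -> b \in s -> om a b != 0.
Proof. by case: coc => nz _ _; apply: nz. Qed.

(** The cocycle identity for [a], [cinv a], [a], with the two remaining factors removed by
    normalization. *)
Lemma cocycle_cinvC a : a \in s -> om (cinv a) a = om a (cinv a).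
Proof.
move=> sa; case: coc => _ om1 /(_ a (cinv a) a sa (mem_cinv sa) sa).
have ca := cs sa; have -> : cmul a (cinv a) = triv by rewrite cmulC (cmul_cinv ca).
rewrite (cmul_cinv ca); have [-> _] := om1 a sa; have [_ ->] := om1 a sa.
by rewrite !mulr1 => ->.
Qed.

Lemma gmul2_pairing (X Y : {ffun gT * gT -> k}) (F : gT -> gT -> k) :
  \sum_a \sum_b gmul2 X Y (a, b) * F a b
    = \sum_x \sum_y X (x, y) * \sum_u \sum_v Y (u, v) * F (x * u)%g (y * v)%g.
Proof.
transitivity (\sum_a \sum_x \sum_b \sum_y
    X (x, y) * Y (x^-1 * a, y^-1 * b)%g * F a b).
  apply: eq_bigr => a _; rewrite exchange_big /=; apply: eq_bigr => b _.
  rewrite ffunE mulr_suml; apply: eq_bigr => x _.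
  by rewrite mulr_suml.
rewrite exchange_big /=; apply: eq_bigr => x _.
rewrite (reindex_inj (mulgI x)) /=.
under eq_bigr => u _ do rewrite exchange_big /=.
rewrite exchange_big /=; apply: eq_bigr => y _; rewrite mulr_sumr.
apply: eq_bigr => u _; rewrite (reindex_inj (mulgI y)) mulr_sumr.
by apply: eq_bigr => v _; rewrite !mulKg mulrA.
Qed.

(** By orthogonality a pair of characters picks out one coefficient of the twist. The coefficients
    [c] are general so as to cover both [om] and its inverse. *)
Lemma twist_pairing (c : {ffun gT -> k} -> {ffun gT -> k} -> k) a b z :
  a \in s -> b \in s ->
  \sum_x \sum_y (\sum_(p <- s) \sum_(q <- s)
     c p q * e_chi H p x * e_chi H q y) * (a x * b y * z) = c a b * z.
Proof.
move=> sa sb.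
transitivity (\sum_(p <- s) \sum_(q <- s) c p q *
    (\sum_x e_chi H p x * a x) * (\sum_y e_chi H q y * b y) * z).
  under eq_bigr => x _.
    under eq_bigr => y _.
      rewrite mulr_suml; under eq_bigr do rewrite mulr_suml.
      over.
    rewrite exchange_big /=; under eq_bigr do rewrite exchange_big /=.
    over.
  rewrite exchange_big /=; apply: eq_bigr => p _; rewrite exchange_big /=.
  apply: eq_bigr => q _.
  transitivity (\sum_x e_chi H p x * a x * (c p q *
      (\sum_y e_chi H q y * b y) * z)); last by rewrite -mulr_suml; ring.
  apply: eq_bigr => x _; rewrite mulr_sumr mulr_suml mulr_sumr.
  by apply: eq_bigr => y _; ring.
rewrite (bigD1_seq a) //= (bigD1_seq b) //= !sum_e_chi ?eqxx //; try exact: cs.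
rewrite !mulr1 big1_seq ?addr0 => [|q /andP[qb sq]]; last first.
  by rewrite sum_e_chi ?(negPf qb) ?mulr0 ?mul0r //; exact: cs.
rewrite big1_seq ?addr0 // => p /andP[pa sp]; apply: big1 => q _.
by rewrite sum_e_chi ?(negPf pa) ?mulr0 ?mul0r //; exact: cs.
Qed.

Lemma twistJ_out x y : ~~ ((x \in H) && (y \in H)) -> twistJ H s om (x, y) = 0.
Proof.
move=> nH; rewrite ffunE; apply: big1 => a _; apply: big1 => b _ /=.
have [Hx|/e_chi_out->] := boolP (x \in H); last by rewrite mulr0 mul0r.
by rewrite [e_chi H b y]e_chi_out ?mulr0 //; rewrite Hx in nH.
Qed.

Lemma twistJinv_out x y :
  ~~ ((x \in H) && (y \in H)) -> twistJinv H s om (x, y) = 0.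
Proof.
move=> nH; rewrite ffunE; apply: big1 => a _; apply: big1 => b _ /=.
have [Hx|/e_chi_out->] := boolP (x \in H); last by rewrite mulr0 mul0r.
by rewrite [e_chi H b y]e_chi_out ?mulr0 //; rewrite Hx in nH.
Qed.

Lemma gcomul_delta_pairing g (F : gT -> gT -> k) (Y : {ffun gT * gT -> k}) :
  \sum_a \sum_b gmul2 (gcomul (delta k g)) Y (a, b) * F a b
    = \sum_u \sum_v Y (u, v) * F (g * u)%g (g * v)%g.
Proof.
have E x y : gcomul (delta k g) (x, y) = ((x == g) && (y == g))%:R.
  rewrite !ffunE /=; have [<-|xy] := eqVneq x y; first by rewrite andbb.
  by have [<-|] := eqVneq x g; rewrite // eq_sym (negPf xy).
rewrite gmul2_pairing (bigD1 g) //= [X in _ + X]big1 ?addr0 => [|x /negPf xg].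
  rewrite (bigD1 g) //= [X in _ + X]big1 ?addr0 => [|y /negPf yg].
    by rewrite E !eqxx mul1r.
  by rewrite E yg andbF mul0r.
by apply: big1 => y _; rewrite E xg mul0r.
Qed.

(** The inverse twist multiplies from the left and so meets the left degrees [a], [c]; the twist
    multiplies from the right and meets [b], [d]. *)
Lemma dmul_bihomogeneousE a b c d f phi g :
  a \in s -> b \in s -> c \in s -> d \in s ->
  bihomogeneous a b f -> bihomogeneous c d phi ->
  (f ** phi) g = (om a c)^-1 * om b d * (f g * phi g).
Proof.
move=> sa sb sc sd hf hphi; rewrite ffunE /twcomul.
under eq_bigr do under eq_bigr do rewrite -mulrA.
rewrite gmul2_pairing.
transitivity (\sum_x \sum_y twistJinv H s om (x, y) *
    (a x * c y * (om b d * (f g * phi g)))).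
  apply: eq_bigr => x _; apply: eq_bigr => y _.
  have [/andP[Hx Hy]|/twistJinv_out->] := boolP ((x \in H) && (y \in H));
    last by rewrite !mul0r.
  congr (_ * _); rewrite (gcomul_delta_pairing g
    (fun u v => f (x * u)%g * phi (y * v)%g)).
  transitivity (\sum_u \sum_v twistJ H s om (u, v) *
    (b u * d v * (a x * c y * (f g * phi g)))).
    apply: eq_bigr => u _; apply: eq_bigr => v _.
    have [/andP[Hu Hv]|/twistJ_out->] := boolP ((u \in H) && (v \in H));
      last by rewrite !mul0r.
    by rewrite !mulgA hf // hphi //; ring.
  under eq_bigr do under eq_bigr do rewrite ffunE.
  by rewrite twist_pairing //; ring.
under eq_bigr do under eq_bigr do rewrite ffunE.
by rewrite (twist_pairing (fun p q => (om p q)^-1)) // mulrA.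
Qed.

Lemma dmul_sumr (I : Type) (r : seq I) (F : I -> {ffun gT -> k}) f :
  f ** (\sum_(i <- r) F i) = \sum_(i <- r) f ** F i.
Proof.
apply/ffunP=> g; rewrite sum_ffunE !ffunE.
under [RHS]eq_bigr do rewrite ffunE; rewrite [RHS]exchange_big /=.
apply: eq_bigr => a _; rewrite [RHS]exchange_big /=; apply: eq_bigr => b _.
by rewrite sum_ffunE mulr_sumr.
Qed.

Lemma dmul_suml (I : Type) (r : seq I) (F : I -> {ffun gT -> k}) f :
  (\sum_(i <- r) F i) ** f = \sum_(i <- r) F i ** f.
Proof.
apply/ffunP=> g; rewrite sum_ffunE !ffunE.
under [RHS]eq_bigr do rewrite ffunE; rewrite [RHS]exchange_big /=.
apply: eq_bigr => a _; rewrite [RHS]exchange_big /=; apply: eq_bigr => b _.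
by rewrite sum_ffunE mulr_sumr mulr_suml.
Qed.

Lemma dmulDr f phi psi : f ** (phi + psi) = f ** phi + f ** psi.
Proof. by have := dmul_sumr [:: phi; psi] id f; rewrite !big_cons !big_nil !addr0. Qed.

Lemma dmulDl f phi psi : (phi + psi) ** f = phi ** f + psi ** f.
Proof. by have := dmul_suml [:: phi; psi] id f; rewrite !big_cons !big_nil !addr0. Qed.

Lemma dmulr0 f : f ** 0 = 0.
Proof. by have := dmul_sumr [::] id f; rewrite !big_nil. Qed.

Lemma dmul0r f : 0 ** f = 0.
Proof. by have := dmul_suml [::] id f; rewrite !big_nil. Qed.

Lemma dmul_combination (I : Type) (r : seq I) (c : I -> k)
    (F : I -> {ffun gT -> k}) f :
  f ** [ffun g => \sum_(i <- r) c i * F i g]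
    = [ffun g => \sum_(i <- r) c i * (f ** F i) g].
Proof.
apply/ffunP=> g; rewrite !ffunE.
under [RHS]eq_bigr do rewrite ffunE mulr_sumr; rewrite [RHS]exchange_big /=.
apply: eq_bigr => a _.
under [RHS]eq_bigr do rewrite mulr_sumr; rewrite [RHS]exchange_big /=.
apply: eq_bigr => b _; rewrite [X in _ * X = _]ffunE mulr_sumr.
by apply: eq_bigr => i _; rewrite mulrCA.
Qed.

Lemma dmul_bihomogeneous a b c d f phi :
  a \in s -> b \in s -> c \in s -> d \in s ->
  bihomogeneous a b f -> bihomogeneous c d phi ->
  bihomogeneous (cmul a c) (cmul b d) (f ** phi).
Proof.
move=> sa sb sc sd hf hphi x y g Hx Hy.
rewrite !(dmul_bihomogeneousE _ sa sb sc sd) // hf // hphi // !ffunE.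
by ring.
Qed.

(** On bihomogeneous functions this is the cocycle identity used twice: inverted for the left
    degrees, and directly for the right degrees. *)
Lemma dmulA f phi psi : f ** (phi ** psi) = f ** phi ** psi.
Proof.
move: f; apply: (bigraded_ind abH) => [|f f' IH IH'|a a' f sa sa' hf].
- by rewrite !dmul0r.
- by rewrite !dmulDl IH IH'.
move: phi; apply: (bigraded_ind abH) => [|f1 f2 IH IH'|b b' phi sb sb' hphi].
- by rewrite !(dmulr0, dmul0r).
- by rewrite !(dmulDl, dmulDr) IH IH'.
move: psi; apply: (bigraded_ind abH) => [|f1 f2 IH IH'|c c' psi sc sc' hpsi].
- by rewrite !dmulr0.
- by rewrite !dmulDr IH IH'.
have h1 := dmul_bihomogeneous sa sa' sb sb' hf hphi.
have h2 := dmul_bihomogeneous sb sb' sc sc' hphi hpsi.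
apply/ffunP=> g.
rewrite (dmul_bihomogeneousE _ sa sa' _ _ hf h2) ?mem_cmul //.
rewrite (dmul_bihomogeneousE _ _ _ sc sc' h1 hpsi) ?mem_cmul //.
rewrite (dmul_bihomogeneousE _ sa sa' sb sb' hf hphi).
rewrite (dmul_bihomogeneousE _ sb sb' sc sc' hphi hpsi).
case: coc => _ _ omA; have E := omA a b c sa sb sc.
have E' := omA a' b' c' sa' sb' sc'.
transitivity ((om b c * om a (cmul b c))^-1 * (om b' c' * om a' (cmul b' c'))
  * (f g * phi g * psi g)); first by rewrite invfM; ring.
by rewrite -E -E' invfM; ring.
Qed.

Lemma dunit_bihomogeneous : bihomogeneous triv triv (dunit k gT).
Proof. by move=> x y g Hx Hy; rewrite !ffunE Hx Hy !mul1r. Qed.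

Lemma dmul1r f : dunit k gT ** f = f.
Proof.
move: f; apply: (bigraded_ind abH) => [|f f' IH IH'|a a' f sa sa' hf].
- exact: dmulr0.
- by rewrite dmulDr IH IH'.
apply/ffunP=> g; case: coc => _ om1 _.
rewrite (dmul_bihomogeneousE _ mem_triv mem_triv sa sa' dunit_bihomogeneous hf).
by have [-> _] := om1 a sa; have [-> _] := om1 a' sa'; rewrite ffunE invr1 !mul1r.
Qed.

Lemma dmulr1 f : f ** dunit k gT = f.
Proof.
move: f; apply: (bigraded_ind abH) => [|f f' IH IH'|a a' f sa sa' hf].
- exact: dmul0r.
- by rewrite dmulDl IH IH'.
apply/ffunP=> g; case: coc => _ om1 _.
rewrite (dmul_bihomogeneousE _ sa sa' mem_triv mem_triv hf dunit_bihomogeneous).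
by have [_ ->] := om1 a sa; have [_ ->] := om1 a' sa'; rewrite ffunE invr1 !mul1r mulr1.
Qed.

(** * The antipode of the twisted dual *)

Lemma sum_bproj_delta2 (C : {ffun gT -> k} * {ffun gT -> k} ->
    {ffun gT -> k} * {ffun gT -> k} -> k) (F : gT -> gT -> k) g h :
  \sum_x \sum_y F x y * (\sum_(p <- bichars) \sum_(q <- bichars)
     C p q * (bproj p.1 p.2 (delta k x) g * bproj q.1 q.2 (delta k y) h))
  = \sum_(p <- bichars) \sum_(q <- bichars)
      C p q * bproj p.1 p.2 (fun x => bproj q.1 q.2 (F x) h) g.
Proof.
under eq_bigr do under eq_bigr do rewrite mulr_sumr.
under eq_bigr do rewrite exchange_big /=.
rewrite exchange_big /=; apply: eq_bigr => p _.
under eq_bigr do under eq_bigr do rewrite mulr_sumr.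
under eq_bigr do rewrite exchange_big /=.
rewrite exchange_big /=; apply: eq_bigr => q _.
rewrite -(sum_bproj_delta p.1 p.2) mulr_sumr; apply: eq_bigr => x _.
rewrite -(sum_bproj_delta q.1 q.2) mulr_suml mulr_sumr; apply: eq_bigr => y _.
by ring.
Qed.

Lemma bihomogeneous_inv a b f (z : k) : bihomogeneous a b f ->
  bihomogeneous (cinv b) (cinv a) [ffun g => z * f g^-1%g].
Proof.
move=> hf x y g Hx Hy; rewrite !ffunE !invMg mulgA hf ?groupV //.
by ring.
Qed.

(* Bidegree [(a, b)] is sent to [(cinv b, cinv a)]; the scalars
   [om (cinv a) a] are the eigenvalues of the element of kH by which the
   antipode of the twisted group algebra differs from the inversion of G. *)
Definition twisted_antipode (z : gT) : {ffun gT -> k} :=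
  \sum_(p <- bichars) [ffun g => (om (cinv p.1) p.1)^-1 * om (cinv p.2) p.2 *
     bproj p.1 p.2 (delta k z) g^-1%g].

Lemma dmul_delta_antipode x y g :
  (delta k x ** twisted_antipode y) g =
  \sum_(p <- bichars) \sum_(q <- bichars)
    (om p.1 (cinv q.2))^-1 * om p.2 (cinv q.1) *
      ((om (cinv q.1) q.1)^-1 * om (cinv q.2) q.2) *
    (bproj p.1 p.2 (delta k x) g * bproj q.1 q.2 (delta k y) g^-1%g).
Proof.
rewrite [delta k x]bigraded_decomposition dmul_suml sum_ffunE.
rewrite [LHS]big_seq [RHS]big_seq; apply: eq_bigr => p /mem_bichars[sp sp'].
rewrite dmul_sumr sum_ffunE.
rewrite [LHS]big_seq [RHS]big_seq; apply: eq_bigr => q /mem_bichars[sq sq'].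
have hp := bproj_bihomogeneous (delta k x) abH sp sp'.
have hq := bproj_bihomogeneous (delta k y) abH sq sq'.
rewrite (dmul_bihomogeneousE _ sp sp' _ _ hp (bihomogeneous_inv _ hq)) ?mem_cinv //.
by rewrite -bigraded_decomposition [X in _ * (_ * X) = _]ffunE; ring.
Qed.

Lemma dmul_antipode_delta x y g :
  (twisted_antipode x ** delta k y) g =
  \sum_(p <- bichars) \sum_(q <- bichars)
    (om (cinv p.2) q.1)^-1 * om (cinv p.1) q.2 *
      ((om (cinv p.1) p.1)^-1 * om (cinv p.2) p.2) *
    (bproj p.1 p.2 (delta k x) g^-1%g * bproj q.1 q.2 (delta k y) g).
Proof.
rewrite dmul_suml sum_ffunE.
rewrite [LHS]big_seq [RHS]big_seq; apply: eq_bigr => p /mem_bichars[sp sp'].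
rewrite [delta k y]bigraded_decomposition dmul_sumr sum_ffunE.
rewrite [LHS]big_seq [RHS]big_seq; apply: eq_bigr => q /mem_bichars[sq sq'].
have hp := bproj_bihomogeneous (delta k x) abH sp sp'.
have hq := bproj_bihomogeneous (delta k y) abH sq sq'.
rewrite (dmul_bihomogeneousE _ _ _ sq sq' (bihomogeneous_inv _ hp) hq) ?mem_cinv //.
by rewrite -bigraded_decomposition [X in _ * (X * _) = _]ffunE; ring.
Qed.

(* The case [u = 1] is the antipode axiom; general [u] computes the adjoint
   action, the commutator of [u] and [g] appearing as the argument. *)
Lemma sum_dmul_delta_antipode u f g : u \in H ->
  \sum_x \sum_y f (u * x * u^-1 * y)%g * (delta k x ** twisted_antipode y) g
    = \sum_(a <- s) \sum_(d <- s) (om a (cinv d))^-1 * om (cinv d) d *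
        bproj a d f (u * g * u^-1 * g^-1)%g.
Proof.
move=> Hu; have cuH z : z \in H -> (u * z = z * u)%g by move=> Hz; apply: (centsP abH).
under eq_bigr do under eq_bigr do rewrite dmul_delta_antipode.
rewrite (sum_bproj_delta2 _ (fun x y => f (u * x * u^-1 * y)%g)).
rewrite (bproj_contract (c := fun a d => (om a (cinv d))^-1 * om (cinv d) d)).
- apply: eq_big_seq => a sa; apply: eq_big_seq => d sd; congr (_ * _).
  rewrite [RHS]ffunE; apply: eq_bigr => x _; apply: eq_bigr => y _.
  have [Hx|/e_chi_out->] := boolP (x \in H); last by rewrite !mul0r.
  by rewrite !mulgA cuH.
- move=> x y z Hz; congr (f _); rewrite !mulgA; congr (_ * _)%g.
  by rewrite -!mulgA (centsP abH _ Hz _ (groupVr Hu)).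
(* For bidegrees [(a, b)] and [(b, d)] the product contributes [om b (cinv b)] and the antipode
   [(om (cinv b) b)^-1]; these cancel, so the coefficient depends only on [a] and [d]. *)
move=> a b d sa sb sd /=; rewrite -(cocycle_cinvC sb).
have nz := cocycle_neq0 (mem_cinv sb) sb.
have nz' := cocycle_neq0 sa (mem_cinv sd).
by field; rewrite nz nz'.
Qed.

(** Both axioms contract to a weighted sum of components of [f] at the identity, where only
    bidegrees [(a, a)] survive, with weight 1. *)
Lemma twisted_antipodeP : is_dual_antipode H s om twisted_antipode.
Proof.
move=> f; split; last first; apply/ffunP=> g;
  rewrite [LHS]ffunE [RHS]ffunE [dunit _ _ _]ffunE mulr1.
  transitivity (\sum_x \sum_y f (1 * x * 1^-1 * y)%g *
    (delta k x ** twisted_antipode y) g).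
    by apply: eq_bigr => x _; apply: eq_bigr => y _; rewrite invg1 mulg1 mul1g.
  rewrite sum_dmul_delta_antipode // invg1 mulg1 mul1g mulgV.
  apply: (sum_bproj1 (c := fun a d => (om a (cinv d))^-1 * om (cinv d) d)) => // a sa.
  by rewrite cocycle_cinvC // mulVf // cocycle_neq0 // mem_cinv.
under eq_bigr do under eq_bigr do rewrite dmul_antipode_delta.
rewrite (sum_bproj_delta2 _ (fun x y => f (x * y)%g)).
rewrite (bproj_contract (c := fun a d => (om (cinv a) a)^-1 * om (cinv a) d)).
- rewrite -(sum_bproj1 (c := fun a d => (om (cinv a) a)^-1 * om (cinv a) d)) //.
    apply: eq_bigr => a _; apply: eq_bigr => d _; congr (_ * _).
    rewrite [RHS]ffunE; apply: eq_bigr => x _; apply: eq_bigr => y _.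
    by rewrite !mulgA mulgKV mulg1.
  by move=> a sa; rewrite mulVf // cocycle_neq0 // mem_cinv.
- by move=> x y z _; rewrite mulgA.
move=> a b d sa sb sd /=.
have nz := cocycle_neq0 (mem_cinv sb) sb.
have nz' := cocycle_neq0 (mem_cinv sa) sa.
by field; rewrite nz nz'.
Qed.

(** * Characters of G in the twisted dual, and the adjoint action *)

Section GroupCharacter.
Variable chi : {ffun gT -> k}.
Hypotheses (chi1 : chi 1%g = 1) (chiM : forall x y, chi (x * y)%g = chi x * chi y).

Local Notation r := (resH H chi).

Lemma charH_resH : is_charH H r.
Proof.
split=> [|x Hx|x y Hx Hy]; rewrite !ffunE ?group1 ?groupM ?Hx ?Hy ?chiM //.
by rewrite (negPf Hx).
Qed.

Lemma mem_resH : r \in s. Proof. exact/mem_s/charH_resH. Qed.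

Lemma group_char_bihomogeneous : bihomogeneous r r chi.
Proof. by move=> x y g Hx Hy; rewrite !chiM !ffunE Hx Hy; ring. Qed.

(** For [f] of bidegree [(a, b)], exchanging the factors changes the scalar by a ratio of values of
    [om], which by the choice of [u] is [a u / b u]. Conjugating the argument by [u] produces the
    same factor. *)
Lemma dmul_group_charC u f : u \in H ->
  (forall b, b \in s -> b u * om b r = om r b) ->
  f ** chi = chi ** [ffun g => f (u * g * u^-1)%g].
Proof.
move=> Hu ru; have sr := mem_resH; have hchi := group_char_bihomogeneous.
move: f; apply: (bigraded_ind abH) => [|f f' IH IH'|a b f sa sb hf].
- rewrite dmul0r (_ : [ffun g => _] = 0) ?dmulr0 //.
  by apply/ffunP=> g; rewrite !ffunE.
- rewrite dmulDl IH IH' -dmulDr; congr (_ ** _).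
  by apply/ffunP=> g; rewrite !ffunE.
have hfu : bihomogeneous a b [ffun g => f (u * g * u^-1)%g].
  move=> x y g Hx Hy; rewrite !ffunE !hf ?groupV //; ring.
apply/ffunP=> g.
rewrite (dmul_bihomogeneousE _ sa sb sr sr hf hchi).
rewrite (dmul_bihomogeneousE _ sr sr sa sb hchi hfu) [in RHS]ffunE.
rewrite hf ?groupV // -(ru a sa) -(ru b sb).
have := charH_mulV (cs sb) Hu; have := charH_neq0 (cs sa) Hu.
have := cocycle_neq0 sa sr => nz nzu bu.
transitivity ((om a r)^-1 * om b r * (b u * b u^-1%g) * (f g * chi g)).
  by rewrite bu mulr1.
by field; rewrite nz nzu.
Qed.

End GroupCharacter.

Lemma dmul_combination_l (I : Type) (r : seq I) (c : I -> k)
    (F : I -> {ffun gT -> k}) f :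
  [ffun g => \sum_(i <- r) c i * F i g] ** f
    = [ffun g => \sum_(i <- r) c i * (F i ** f) g].
Proof.
apply/ffunP=> g; rewrite !ffunE.
under [RHS]eq_bigr do rewrite ffunE mulr_sumr; rewrite [RHS]exchange_big /=.
apply: eq_bigr => a _.
under [RHS]eq_bigr do rewrite mulr_sumr; rewrite [RHS]exchange_big /=.
apply: eq_bigr => b _; rewrite [X in _ * X * _ = _]ffunE mulr_sumr mulr_suml.
by apply: eq_bigr => i _; ring.
Qed.

(** In each term [x] is moved in front of [delta k a]; the conjugation this leaves on [delta k a] is
    reindexed into the argument of [f]. *)
Lemma dad_conj u t f x :
  (forall phi, phi ** x = x ** [ffun g => phi (u * g * u^-1)%g]) ->
  dad H s om t f x = x ** [ffun g => \sum_y \sum_z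
     f (u * y * u^-1 * z)%g * (delta k y ** t z) g].
Proof.
move=> xu.
rewrite (_ : [ffun g => _] = [ffun g => \sum_(p : gT * gT)
   f (u * p.1 * u^-1 * p.2)%g * (delta k p.1 ** t p.2) g]); last first.
  by apply/ffunP=> g; rewrite [LHS]ffunE [RHS]ffunE pair_big.
rewrite dmul_combination; apply/ffunP=> g; rewrite [LHS]ffunE [RHS]ffunE.
rewrite -(pair_big predT predT (fun y z => f (u * y * u^-1 * z)%g *
  (x ** (delta k y ** t z)) g)) /=.
rewrite (reindex_inj (mulgI u)) (reindex_inj (mulIg u^-1%g)) /=.
apply: eq_bigr => y _; apply: eq_bigr => z _; rewrite !mulgA; congr (_ * _).
rewrite dmulA xu; congr ((_ ** _ ** _) g).
apply/ffunP=> v; rewrite !ffunE.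
by rewrite (inj_eq (mulIg _)) (inj_eq (mulgI _)).
Qed.

(** With [x] moved to the front, what remains is the antipode axiom, so the action is through the
    counit. *)
Lemma dad_central t f x : is_dual_antipode H s om t ->
  (forall phi, phi ** x = x ** phi) -> dad H s om t f x = [ffun g => f 1%g * x g].
Proof.
move=> St xC; rewrite (@dad_conj 1%g) => [|phi]; last first.
  by rewrite xC; congr (_ ** _); apply/ffunP=> g; rewrite ffunE invg1 mulg1 mul1g.
(* The scalar multiple is written as a one-term sum to fit [dmul_combination]. *)
rewrite (_ : [ffun g => _] = [ffun g => \sum_(i <- [:: tt]) f 1%g * dunit k gT g]).
  rewrite (dmul_combination _ (fun=> f 1%g) (fun=> dunit k gT)) dmulr1.
  by apply/ffunP=> g; rewrite !ffunE big_seq1.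
have [_ /ffunP Sf] := St f; apply/ffunP=> g; move: (Sf g).
rewrite !ffunE big_seq1 => <-; apply: eq_bigr => y _; apply: eq_bigr => z _.
by rewrite invg1 mulg1 mul1g.
Qed.

(** A character of G has equal left and right degrees, so the two twisting scalars cancel. *)
Lemma dmul_group_chars (chi psi : {ffun gT -> k}) :
  chi 1%g = 1 -> (forall x y, chi (x * y)%g = chi x * chi y) ->
  psi 1%g = 1 -> (forall x y, psi (x * y)%g = psi x * psi y) ->
  chi ** psi = cmul chi psi.
Proof.
move=> chi1 chiM psi1 psiM; apply/ffunP=> g.
have sc := mem_resH chi1 chiM; have sp := mem_resH psi1 psiM.
rewrite (dmul_bihomogeneousE _ sc sc sp sp (group_char_bihomogeneous chiM)
  (group_char_bihomogeneous psiM)).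
by rewrite mulVf ?mul1r ?ffunE // cocycle_neq0.
Qed.

(** * Biduality for H and the point attached to a character *)

Lemma grouplike_delta (G : gT -> k) : \sum_(h in H) G h = 1 ->
  (forall a b, a \in s -> b \in s ->
     (\sum_(h in H) G h * a h) * (\sum_(h in H) G h * b h)
       = \sum_(h in H) G h * (a h * b h)) ->
  exists2 u, u \in H & forall h, h \in H -> G h = (h == u)%:R.
Proof.
move=> G1 GM.
(* The hypothesis says that [G] tensor [G] and the coproduct of [G] agree against all pairs of
   characters; separation is applied in each variable in turn. *)
have GG x y : x \in H -> y \in H -> G x * G y = (x == y)%:R * G x.
  move=> Hx Hy; apply/eqP; rewrite -subr_eq0; apply/eqP; move: x Hx.
  apply: sep_s => a sa.
  transitivity ((\sum_(x in H) G x * a x) * G y - G y * a y); last first.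
    move: y Hy; apply: sep_s => b sb.
    under eq_bigr do rewrite mulrBl -!mulrA.
    by rewrite sumrB -mulr_sumr GM ?subrr.
  under eq_bigr do rewrite mulrBl; rewrite sumrB mulr_suml; congr (_ - _).
    by apply: eq_bigr => x _; rewrite mulrAC.
  rewrite (bigD1 y) //= eqxx mul1r big1 ?addr0 // => x /andP[_ /negPf->].
  by rewrite !mul0r.
have [u Hu nzu] : exists2 u, u \in H & G u != 0.
  apply/exists_inP; apply: contra_eqT G1; rewrite negb_exists_in.
  by move=> /forall_inP G0; rewrite big1 1?eq_sym ?oner_eq0 // => h /G0/negPn/eqP.
exists u => // h Hh; have [->|hu] := eqVneq h u.
  by apply: (mulfI nzu); rewrite GG // eqxx mulr1 mul1r.
by apply: (mulIf nzu); rewrite GG // (negPf hu) !mul0r.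
Qed.

(** The inverse Fourier transform [U] of [lam] pairs with [b] to [lam b]; multiplicativity of [lam]
    makes [U] grouplike, hence a point of [H]. *)
Lemma dual_group_evaluation (lam : {ffun gT -> k} -> k) : lam triv = 1 ->
  (forall a b, a \in s -> b \in s -> lam (cmul a b) = lam a * lam b) ->
  exists2 u, u \in H & forall a, a \in s -> a u = lam a.
Proof.
move=> lam1 lamM; pose U h := \sum_(a <- s) lam a * e_chi H a h.
have UE b : b \in s -> \sum_(h in H) U h * b h = lam b.
  move=> sb; under eq_bigr do rewrite mulr_suml; rewrite exchange_big /=.
  rewrite (eq_big_seq (fun a => lam a * (a == b)%:R)) => [|a sa].
    rewrite (bigD1_seq b) //= eqxx mulr1 big1 ?addr0 // => a /negPf->.
    by rewrite mulr0.
  under eq_bigr do rewrite -mulrA; rewrite -mulr_sumr; congr (_ * _).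
  rewrite -(sum_e_chi nzH (cs sa) (cs sb)) [RHS](bigID (mem H)) /=.
  by rewrite [X in _ + X]big1 ?addr0 // => h Hh; rewrite e_chi_out ?mul0r.
have [|a b sa sb|u Hu Uu] := @grouplike_delta U.
- rewrite -[RHS]lam1 -(UE _ mem_triv); apply: eq_bigr => h Hh.
  by rewrite ffunE Hh mulr1.
- rewrite !UE // -lamM // -UE ?mem_cmul //.
  by apply: eq_bigr => h _; rewrite ffunE.
exists u => // a sa; rewrite -(UE a sa) (bigD1 u) //= Uu // eqxx mul1r.
rewrite big1 ?addr0 // => h /andP[Hh /negPf hu].
by rewrite Uu // hu mul0r.
Qed.

(** The quotient [om a b / om b a] is multiplicative in [b]: after clearing denominators this
    combines the cocycle identities for [(a, b, c)], [(b, c, a)] and [(b, a, c)]. Biduality then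
    supplies [u]. *)
Lemma cocycle_commutation a : a \in s ->
  exists2 u, u \in H & forall b, b \in s -> b u * om b a = om a b.
Proof.
move=> sa; have [||u Hu uE] := @dual_group_evaluation (fun b => om a b / om b a).
- by case: coc => _ om1 _; have [-> ->] := om1 a sa; rewrite divr1.
- move=> b c sb sc; case: coc => _ _ omA.
  have E1 := omA a b c sa sb sc; have E2 := omA b c a sb sc sa.
  have E3 := omA b a c sb sa sc.
  rewrite (cmulC b a) in E3; rewrite (cmulC c a) in E2.
  have nz1 := cocycle_neq0 sb sa; have nz2 := cocycle_neq0 sc sa.
  have nz3 := cocycle_neq0 sb sc.
  have nz4 := cocycle_neq0 (mem_cmul sb sc) sa.
  have nz5 := cocycle_neq0 sb (mem_cmul sa sc).
  have nz6 := cocycle_neq0 (mem_cmul sa sb) sc.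
  rewrite mulf_div; apply/eqP; rewrite eqr_div ?mulf_neq0 //; apply/eqP.
  apply: (mulfI nz3); apply: (mulfI nz5); apply: (mulfI nz6).
  transitivity ((om b c * om a (cmul b c)) * (om b a * om (cmul a b) c)
     * (om c a * om b (cmul a c))); first by ring.
  by rewrite -E1 E3 -E2; ring.
by exists u => // b sb; rewrite uE // divfK // cocycle_neq0.
Qed.

(** Every idempotent takes the same value at [h] as at 1, while their sum is the indicator of 1. *)
Lemma charH_point_separation h : h \in H -> (forall a, a \in s -> a h = 1) -> h = 1%g.
Proof.
move=> Hh ah; apply/eqP; have := e_sum h; case: eqP => //= _ /eqP.
rewrite (eq_big_seq (fun a => e_chi H a 1%g)) => [|a sa].
  by rewrite e_sum eqxx oner_eq0.
have ca := cs sa; case: (ca) => a1 _ _.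
rewrite !ffunE Hh group1 invg1 a1; have := charH_mulV ca Hh.
by rewrite ah // mul1r => ->.
Qed.

Lemma fourier_inversion (phi : gT -> k) y : y \in H ->
  phi y = \sum_(a <- s) (\sum_z phi z * e_chi H a z) * a y.
Proof.
move=> Hy; under eq_bigr do rewrite mulr_suml; rewrite exchange_big /=.
rewrite (eq_bigr (fun z => phi z * (z == y)%:R)) => [|z _].
  rewrite (bigD1 y) //= eqxx mulr1 big1 ?addr0 // => z /negPf->.
  by rewrite mulr0.
under eq_bigr do rewrite -mulrA; rewrite -mulr_sumr; congr (_ * _).
have -> : (z == y) = (y^-1 * z == 1)%g by rewrite -eq_mulVg1 eq_sym.
rewrite -e_sum; apply: eq_big_seq => a sa.
by rewrite e_chi_mul ?groupV ?invgK 1?mulrC //; apply: cs.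
Qed.

End Bigrading.

(** * Normal quotients *)

Lemma char_enum_exists (k : closedFieldType) (gT : finGroupType)
    (H : {group gT}) : [pchar k] =i pred0 -> abelian H ->
  exists2 s : seq {ffun gT -> k}, char_enum H s & separates H s.
Proof.
move=> ch0 abH; have [s [us cs sep]] := character_separation ch0 abH.
exists s => //; split=> // a; split=> [/cs//|ca].
have nz : #|H|%:R != 0 :> k by rewrite ((pcharf0P k).1 ch0) -lt0n cardG_gt0.
apply: contraT => sa; have : e_chi H a 1%g = 0.
  apply: sep => // b sb; have cb := cs b sb; transitivity ((a == b)%:R : k).
    rewrite -(sum_e_chi nz ca cb) [RHS](bigID (mem H)) /=.
    by rewrite [X in _ + X]big1 ?addr0 // => h Hh; rewrite e_chi_out ?mul0r.
  by case: eqP => // ab; rewrite ab sb in sa.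
case: ca => a1 _ _; rewrite ffunE group1 invg1 a1 mulr1 => /eqP.
by rewrite invr_eq0 (negPf nz).
Qed.

(** * Elements of prime order centralizing the kernel *)

Lemma central_of_prime_index (gT fT : finGroupType) (f : gT -> fT) u :
  (forall x y, f (x * y) = f x * f y)%g -> (forall y, exists x, f x = y) ->
  prime #|fT| -> ('Z([set: gT]) = 1)%g -> (u ^+ #|fT| = 1)%g ->
  (forall n, f n = 1 -> u * n = n * u)%g -> u = 1%g.
Proof.
move=> fM fsurj pr_p Z1 up uC; set p := #|fT| in pr_p up.
apply: contraTeq isT => u1.
pose fm := Morphism (fun x y (_ : x \in [set: gT]) (_ : y \in [set: gT]) => fM x y).
have imf : (fm @* [set: gT] = [set: fT])%g.
  apply/setP=> y; rewrite inE; have [x <-] := fsurj y.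
  by apply/morphimP; exists x; rewrite ?inE.
pose N := ('ker fm)%G; pose M := ('C(N))%G.
have nN : (N <| [set: gT])%g by apply: ker_normal.
have nM : (M <| [set: gT])%g.
  by rewrite /normal subsetT /= norms_cent // normal_norm.
have Mu : u \in M.
  apply/centP=> n; rewrite inE => /andP[_]; rewrite !inE => /eqP fn.
  exact: uC.
have ou : #[u]%g = p by apply: nt_prime_order.
have pM : (p %| #|M|)%N by rewrite -ou order_dvdG.
have [P sylP] := Sylow_exists p [set: gT]%G.
have pP : (p.-group P)%g := pHall_pgroup sylP.
have sylPM : (p.-Sylow(M) (M :&: P))%g := Sylow_setI_normal nM sylP.
have nt : (M :&: P != 1)%g.
  rewrite -cardG_gt1 (card_Hall sylPM) p_part.
  by rewrite -(expn0 p) ltn_exp2l ?prime_gt1 // logn_gt0 mem_primes pr_p cardG_gt0.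
have nMP : (M :&: P <| P)%g by rewrite setIC; apply: normalGI (subsetT P) nM.
(* A nontrivial normal subgroup of a p-group meets its center, giving [z] that centralizes both [N]
   and [P]. *)
have /trivgPn[z] := meet_center_nil (pgroup_nil pP) nMP nt.
case/setIP=> /setIP[Mz _] /setIP[_ cPz] z1.
(* The image of [P] is a Sylow p-subgroup of a group of order p, hence everything; thus [N] and [P]
   together generate G. *)
have fP : (fm @* P = [set: fT])%g.
  have /card_Hall := morphim_pHall fm (subsetT P) sylP.
  rewrite /= imf cardsT -/p part_pnat_id ?pnat_id // => cP.
  by apply/eqP; rewrite eqEcard subsetT cP cardsT /=.
have : z \in 'Z([set: gT])%g.
  apply/centerP; split; rewrite ?inE // => y _.
  have : f y \in (fm @* P)%g by rewrite fP inE.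
  case/morphimP=> x _ Px fyx.
  have yx : f (y * x^-1)%g = 1%g.
    have f1 : f 1%g = 1%g by apply: (mulgI (f 1%g)); rewrite -fM !mulg1.
    by rewrite fM fyx -[f x^-1%g]/(fm x^-1%g) -fM mulgV.
  have Ny : (y * x^-1)%g \in N by rewrite !inE /=; apply/eqP.
  have c1 := centP Mz _ Ny; have c2 := centP cPz _ Px.
  by rewrite -[y](mulgKV x); apply: commuteM.
by rewrite Z1 inE (negPf z1).
Qed.

(** * Hopf quotients onto a group algebra *)

Section Quotient.
Variables (k : fieldType) (gT fT : finGroupType) (H : {group gT}).
Variables (s : seq {ffun gT -> k}) (sF : seq {ffun fT -> k}).
Variables (om : {ffun gT -> k} -> {ffun gT -> k} -> k).
Hypotheses (nzH : #|H|%:R != 0 :> k) (nzF : #|[set: fT]|%:R != 0 :> k).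
Hypotheses (uniq_s : uniq s) (mem_s : forall a, a \in s <-> is_charH H a).
Hypothesis sep_s : separates H s.
Hypotheses (uniq_sF : uniq sF)
  (mem_sF : forall mu, mu \in sF <-> is_charH [set: fT]%G mu).
Hypothesis sep_sF : separates [set: fT]%G sF.
Hypotheses (coc : omega_cocycle H s om) (abH : abelian H).

Lemma is_fcharP (mu : {ffun fT -> k}) : is_fchar mu <-> is_charH [set: fT]%G mu.
Proof.
split=> [[mu1 muM]|[mu1 _ muM]]; split=> //.
  by move=> x; rewrite inE.
by move=> x y; apply: muM; rewrite inE.
Qed.

Lemma mu_piM (pig : gT -> {ffun fT -> k}) mu g h : is_fchar mu ->
  pig (g * h)%g = fmul (pig g) (pig h) ->
  mu_pi pig mu (g * h)%g = mu_pi pig mu g * mu_pi pig mu h.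
Proof.
move=> [_ muM] E; rewrite /mu_pi E mulr_suml.
under eq_bigr do rewrite ffunE mulr_sumr.
rewrite exchange_big /=; apply: eq_bigr => x _.
rewrite (reindex_inj (mulgI x)) mulr_sumr; apply: eq_bigr => y _.
by rewrite mulKg muM; ring.
Qed.

(* A character of G is multiplicative for the twisted comultiplication as
   well, so [pig g] is grouplike in kF, i.e. an element of F. *)
Lemma quotient_hopf_map_group (pig : gT -> {ffun fT -> k}) :
  quotient_hopf_map H s om pig ->
  exists f : gT -> fT,
    [/\ forall x y, f (x * y)%g = (f x * f y)%g,
        forall y, exists x, f x = y
      & forall g u, pig g u = (u == f g)%:R].
Proof.
case=> pig1 pigM pige pigD pigs.
have pchar mu : is_fchar mu -> mu_pi pig mu 1%g = 1.
  move=> [mu1 _]; rewrite /mu_pi pig1 (bigD1 1%g) //= ffunE eqxx mu1 mulr1.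
  by rewrite big1 ?addr0 // => u /negPf u1; rewrite ffunE u1 mulr0.
have /fin_all_exists[f fE] : forall g, exists u, forall v, pig g v = (v == u)%:R.
  move=> g; have [||u _ uE] := grouplike_delta sep_sF (G := pig g).
  - by rewrite -[RHS](pige g); apply: eq_bigl => u; rewrite inE.
  - move=> mu nu /mem_sF/is_fcharP cmu /mem_sF/is_fcharP cnu.
    pose cm := [ffun x => mu_pi pig mu x]; pose cn := [ffun x => mu_pi pig nu x].
    have setF (G : fT -> k) : \sum_(u in [set: fT]) G u = \sum_u G u.
      by apply: eq_bigl => u; rewrite inE.
    have E (x : {ffun fT -> k}) :
        \sum_(u in [set: fT]) pig g u * x u = mu_pi pig x g.
      by rewrite setF; apply: eq_bigr => u _; rewrite mulrC.
    rewrite !E.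
    have := dmul_group_chars nzH uniq_s mem_s coc (chi := cm) (psi := cn).
    move=> /(_ _ _ _ _)/ffunP/(_ g); rewrite !ffunE => <-.
    + rewrite setF.
      transitivity (\sum_u \sum_v mu u * nu v * (if u == v then pig g u else 0)).
        under [RHS]eq_bigr do under eq_bigr do rewrite -pigD mulr_sumr.
        under [RHS]eq_bigr do rewrite exchange_big.
        rewrite [RHS]exchange_big /=; apply: eq_bigr => a _.
        under [RHS]eq_bigr do under eq_bigr do rewrite mulr_sumr.
        under [RHS]eq_bigr do rewrite exchange_big.
        rewrite [RHS]exchange_big /=; apply: eq_bigr => b _.
        rewrite [cm _]ffunE [cn _]ffunE -mulrA mulr_suml mulr_sumr.
        apply: eq_bigr => u _; rewrite !mulr_sumr; apply: eq_bigr => v _.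
        by ring.
      apply: eq_bigr => u _; rewrite (bigD1 u) //= eqxx big1 ?addr0 => [|v].
        by rewrite mulrC.
      by rewrite eq_sym => /negPf->; rewrite mulr0.
    + by rewrite pchar.
    + by move=> x y; rewrite !ffunE mu_piM.
    + by rewrite pchar.
    + by move=> x y; rewrite !ffunE mu_piM.
  by exists u => v; rewrite uE ?inE.
exists f; split=> // [x y|y].
  have := fE (x * y)%g (f x * f y)%g; rewrite pigM ffunE (bigD1 (f x)) //=.
  rewrite !fE eqxx mulKg eqxx mulr1 big1 ?addr0 => [|z /negPf zx]; last first.
    by rewrite fE zx mul0r.
  by case: eqP => // _ /eqP; rewrite oner_eq0.
(* If no [f g] equals [y], every element of the image has coefficient 0 at [y], contradicting that
   the basis element [y] is hit. *)
have [c /(_ y)] := pigs [ffun u => (u == y)%:R].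
have [/existsP[g /eqP fg] _|/existsPn nf] := boolP [exists g, f g == y].
  by exists g.
rewrite ffunE eqxx big1 => [/eqP|g _]; first by rewrite oner_eq0.
by rewrite fE eq_sym (negPf (nf g)) mulr0.
Qed.

(** * Normality against regularity of the restricted characters *)

Section Normality.
Variables (pig : gT -> {ffun fT -> k}) (f : gT -> fT).
Hypotheses (fM : forall x y, f (x * y)%g = (f x * f y)%g)
  (fsurj : forall y, exists x, f x = y)
  (pigE : forall g u, pig g u = (u == f g)%:R).

Lemma sum_pig (phi : fT -> k) g : \sum_u phi u * pig g u = phi (f g).
Proof.
rewrite (bigD1 (f g)) //= pigE eqxx mulr1 big1 ?addr0 // => u /negPf uf.
by rewrite pigE uf mulr0.
Qed.

Lemma pi_dual_imageP (x : {ffun gT -> k}) :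
  pi_dual_image pig x <-> exists phi : {ffun fT -> k}, x = [ffun g => phi (f g)].
Proof.
split=> [[phi xE]|[phi ->]]; exists phi.
  by apply/ffunP=> g; rewrite ffunE xE sum_pig.
by move=> g; rewrite ffunE sum_pig.
Qed.

Definition pullback (mu : {ffun fT -> k}) : {ffun gT -> k} := [ffun g => mu (f g)].

Lemma resH_mu_pi mu : resH H (mu_pi pig mu) = resH H (pullback mu).
Proof. by apply/ffunP=> g; rewrite !ffunE [mu_pi _ _ _]sum_pig. Qed.

Lemma morph1 : f 1%g = 1%g.
Proof. by apply: (mulgI (f 1%g)); rewrite -fM !mulg1. Qed.

Lemma pullback1 mu : is_fchar mu -> pullback mu 1%g = 1.
Proof. by case=> mu1 _; rewrite ffunE morph1. Qed.

Lemma pullbackM mu : is_fchar mu ->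
  forall x y, pullback mu (x * y)%g = pullback mu x * pullback mu y.
Proof. by case=> _ muM x y; rewrite !ffunE fM muM. Qed.

Lemma mem_resH_pullback mu : is_fchar mu -> resH H (pullback mu) \in s.
Proof. by move=> cmu; apply: (mem_resH mem_s (pullback1 cmu) (pullbackM cmu)). Qed.

(** Fourier inversion on F, transported along [f]. *)
Lemma pi_dual_image_characters (x : {ffun gT -> k}) : pi_dual_image pig x ->
  exists c : {ffun fT -> k} -> k, x = [ffun g => \sum_(mu <- sF) c mu * pullback mu g].
Proof.
case/pi_dual_imageP=> phi ->; exists (fun mu => \sum_z phi z * e_chi [set: fT]%G mu z).
apply/ffunP=> g; rewrite !ffunE.
rewrite (fourier_inversion nzF uniq_sF mem_sF sep_sF phi) ?inE //.
by apply: eq_bigr => mu _; rewrite ffunE.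
Qed.

(** Regularity allows [u = 1] in the commutation rule, so the pulled-back characters, and with them
    the whole image, are central; the adjoint action then only rescales. *)
Lemma normal_of_regular :
  (forall mu, is_fchar mu -> omega_regular s om (resH H (mu_pi pig mu))) ->
  normal_quotient H s om pig.
Proof.
move=> reg t St phi x pix.
have xC psi : dmul H s om psi x = dmul H s om x psi.
  have [c ->] := pi_dual_image_characters pix.
  rewrite dmul_combination dmul_combination_l; apply/ffunP=> g.
  rewrite [LHS]ffunE [RHS]ffunE; apply: eq_big_seq => mu /mem_sF/is_fcharP cmu.
  rewrite (dmul_group_charC nzH uniq_s mem_s sep_s coc abH (pullback1 cmu)
    (pullbackM cmu) psi (group1 H)).
    congr (_ * (dmul _ _ _ _ _) g).
    by apply/ffunP=> z; rewrite ffunE invg1 mulg1 mul1g.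
  move=> b sb; have [-> _ _] := (mem_s b).1 sb; rewrite mul1r.
  by have := reg mu cmu b sb; rewrite resH_mu_pi.
rewrite (dad_central nzH uniq_s mem_s sep_s coc abH phi St xC).
case/pi_dual_imageP: pix => xi ->; apply/pi_dual_imageP.
by exists [ffun y => phi 1%g * xi y]; apply/ffunP=> g; rewrite !ffunE.
Qed.

Lemma commutation_centralizes_kernel mu u : normal_quotient H s om pig ->
  is_fchar mu -> u \in H ->
  (forall b, b \in s ->
     b u * om b (resH H (pullback mu)) = om (resH H (pullback mu)) b) ->
  forall n, f n = 1%g -> (u * n = n * u)%g.
Proof.
move=> nq cmu Hu ru n fn; set chi := pullback mu in ru.
have chi1 := pullback1 cmu; have chiM := pullbackM cmu; rewrite -/chi in chi1 chiM.
have St := twisted_antipodeP nzH uniq_s mem_s sep_s coc abH.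
pose S := twisted_antipode H s om.
pose W phi := [ffun g => \sum_y \sum_z
  phi (u * y * u^-1 * z)%g * dmul H s om (delta k y) (S z) g].
have chiC phi := dmul_group_charC nzH uniq_s mem_s sep_s coc abH chi1 chiM phi Hu ru.
pose mu' := cinv mu; pose chi' := pullback mu'.
have cmu' : is_fchar mu' by apply/is_fcharP/charH_cinv/is_fcharP.
have W1 (phi : {ffun gT -> k}) : W phi n = W phi 1%g.
  have pix : pi_dual_image pig chi by apply/pi_dual_imageP; exists mu.
  have := nq _ St phi _ pix.
  rewrite (dad_conj nzH uniq_s mem_s sep_s coc abH _ _ chiC) -/(W phi).
  move=> /pi_dual_image_characters[c Wc].
  (* The adjoint action on [chi] is [chi] times [W phi]. Multiplying by its inverse [chi'] keeps it
     a combination of pulled-back characters, so [W phi] cannot distinguish [n] from 1. *)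
  have -> : W phi = dmul H s om chi' (dmul H s om chi (W phi)).
    rewrite (dmulA nzH uniq_s mem_s sep_s coc abH).
    rewrite (dmul_group_chars nzH uniq_s mem_s coc (pullback1 cmu')
      (pullbackM cmu') chi1 chiM).
    rewrite (_ : cmul _ _ = dunit k gT) ?(dmul1r nzH uniq_s mem_s sep_s coc abH) //.
    apply/ffunP=> g; rewrite !ffunE mulrC.
    by apply: (@charH_mulV _ _ [set: fT]%G); [apply/is_fcharP|rewrite inE].
  rewrite Wc dmul_combination [LHS]ffunE [RHS]ffunE.
  apply: eq_big_seq => nu /mem_sF/is_fcharP cnu; congr (_ * _).
  rewrite (dmul_group_chars nzH uniq_s mem_s coc (pullback1 cmu') (pullbackM cmu')
    (pullback1 cnu) (pullbackM cnu)).
  by rewrite !ffunE fn morph1.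
have hom1 a d (phi : {ffun gT -> k}) : a \in s -> d \in s -> bihomogeneous H a d phi ->
    phi (u * n * u^-1 * n^-1)%g = phi 1%g.
  move=> sa sd hphi; move: (W1 phi); rewrite ![W phi _]ffunE.
  rewrite !(sum_dmul_delta_antipode nzH uniq_s mem_s sep_s coc abH) //.
  (* For bihomogeneous [phi] one term survives, with a nonzero scalar that cancels from both sides
     of [W1]. *)
  have D z : \sum_(a' <- s) \sum_(d' <- s) (om a' (cinv d'))^-1 * om (cinv d') d' *
      bproj H a' d' phi z = (om a (cinv d))^-1 * om (cinv d) d * phi z.
    rewrite (bigD1_seq a) //= (bigD1_seq d) //=.
    rewrite (bproj_of_bihomogeneous nzH mem_s sa sd sa sd hphi) !eqxx /=.
    rewrite big1_seq ?addr0 => [|d' /andP[dd sd']]; last first.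
      rewrite (bproj_of_bihomogeneous nzH mem_s sa sd sa sd' hphi) (negPf dd) andbF.
      by rewrite ffunE mulr0.
    rewrite big1_seq ?addr0 // => a' /andP[aa sa'].
    rewrite big1_seq // => d' /andP[_ sd'].
    rewrite (bproj_of_bihomogeneous nzH mem_s sa sd sa' sd' hphi) (negPf aa).
    by rewrite ffunE mulr0.
  rewrite !D => /mulfI; rewrite mulg1 mulgV invg1 mulg1; apply.
  have sd' := mem_cinv mem_s sd.
  by rewrite mulf_neq0 ?invr_eq0 // (cocycle_neq0 coc).
(* All bihomogeneous functions agree at the commutator and at 1, hence so does the indicator of 1,
   whose components are bihomogeneous. *)
suff : delta k (1 : gT)%g (u * n * u^-1 * n^-1)%g = 1.
  rewrite ffunE -eq_mulgV1; case: eqP => [E _|_ /esym/eqP];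
    last by rewrite oner_eq0.
  by rewrite -[in RHS]E mulgKV.
transitivity (delta k (1 : gT)%g 1%g); last by rewrite ffunE eqxx.
rewrite -!(sum_bproj nzH uniq_s mem_s sep_s (delta k (1 : gT)%g)).
apply: eq_big_seq => p /mem_bichars[sp sp'].
apply: (hom1 p.1 p.2) => //.
exact: (bproj_bihomogeneous mem_s _ abH sp sp').
Qed.

Lemma regular_of_normal : prime #|fT| -> ('Z([set: gT]) = 1)%g ->
  normal_quotient H s om pig ->
  forall mu, is_fchar mu -> omega_regular s om (resH H (mu_pi pig mu)).
Proof.
move=> pr_p Z1 nq mu cmu; rewrite resH_mu_pi; set r := resH H (pullback mu).
have sr : r \in s := mem_resH_pullback cmu.
have [u Hu ru] := cocycle_commutation nzH uniq_s mem_s sep_s coc sr.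
have uC := commutation_centralizes_kernel nq cmu Hu ru.
have up : (u ^+ #|fT| = 1)%g.
  apply: (charH_point_separation nzH uniq_s mem_s sep_s); first exact: groupX.
  move=> b sb; have cb := (mem_s b).1 sb.
  have bX m : b (u ^+ m)%g = b u ^+ m.
    elim: m => [|m IH]; first by case: cb.
    by case: cb => _ _ bM; rewrite expgS exprS bM ?groupX // IH.
  (* With [v] attached to [b] as [u] is to [r], the two commutation factors are inverse:
     [b u * r v = 1]. Since [r v = mu (f v)] has trivial power of exponent the order of F, so does
     [b u]. *)
  have [v Hv vr] := cocycle_commutation nzH uniq_s mem_s sep_s coc sb.
  have nz := cocycle_neq0 coc sr sb.
  have bu : b u * r v = 1.
    by apply: (mulIf nz); rewrite mul1r -mulrA vr // ru.
  have rX m : mu (f v ^+ m)%g = r v ^+ m.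
    elim: m => [|m IH]; first by case: cmu.
    by case: cmu => _ muM; rewrite expgS exprS muM IH !ffunE Hv.
  have : (b u * r v) ^+ #|fT| = 1 by rewrite bu expr1n.
  rewrite exprMn -bX -rX -cardsT expg_cardG ?inE //.
  by case: cmu => -> _; rewrite mulr1.
have u1 := central_of_prime_index fM fsurj pr_p Z1 up uC.
by move=> b sb; rewrite -(ru b sb) u1; have [-> _ _] := (mem_s b).1 sb; rewrite mul1r.
Qed.

End Normality.
End Quotient.

Theorem theorem3p3 (k : closedFieldType) (gT fT : finGroupType) (H : {group gT})
    (s : seq {ffun gT -> k}) (om : {ffun gT -> k} -> {ffun gT -> k} -> k)
    (p : nat) (pig : gT -> {ffun fT -> k}) :
  [pchar k] =i pred0 ->
  ('Z([set: gT]) = 1)%g ->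
  abelian H ->
  char_enum H s ->
  omega_cocycle H s om ->
  prime p -> (p %| #|gT|)%N ->
  (forall q, prime q -> (q %| #|gT|)%N -> (p <= q)%N) ->
  #|fT| = p ->
  quotient_hopf_map H s om pig ->
  (normal_quotient H s om pig <->
     (forall mu, is_fchar mu -> omega_regular s om (resH H (mu_pi pig mu))))
  /\
  (omega_nondegenerate H s om ->
     (normal_quotient H s om pig <->
        (forall mu, is_fchar mu -> resH H (mu_pi pig mu) = chartriv k H))).
Proof.
move=> ch0 Z1 abH [us mem_s] coc pr_p _ _ cardF qh.
have nz (rT : finGroupType) (G : {group rT}) : #|G|%:R != 0 :> k.
  by rewrite ((pcharf0P k).1 ch0) -lt0n cardG_gt0.
have abF : abelian [set: fT] by rewrite cyclic_abelian // prime_cyclic // cardsT cardF.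
have [sF [usF mem_sF] sepF] := char_enum_exists ch0 abF.
have [s' [_ cs'] sep'] := char_enum_exists ch0 abH.
(* The given list contains every character of the separating list [s'], hence separates too. *)
have sep : separates H s.
  by move=> x xs; apply: sep' => a /cs'/mem_s; apply: xs.
have [f [fM fsurj pigE]] := quotient_hopf_map_group (nz _ H) us mem_s mem_sF sepF coc qh.
have reg : normal_quotient H s om pig <->
    (forall mu, is_fchar mu -> omega_regular s om (resH H (mu_pi pig mu))).
  split; last first.
    exact: (normal_of_regular (nz _ H) (nz _ [set: fT]%G) us mem_s sep usF mem_sF
      sepF coc abH fM pigE).
  apply: (regular_of_normal (nz _ H) (nz _ [set: fT]%G) us mem_s sep usF mem_sF
    sepF coc abH fM fsurj pigE) => //.
  by rewrite cardF.
(* Non-degeneracy turns regular into trivial; conversely the trivial character is regular because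
   [om] is normalized. *)
split=> // nd; rewrite reg; split=> [regmu mu cmu|triv mu cmu b sb].
  apply: nd (regmu mu cmu); rewrite (resH_mu_pi H pigE).
  exact: (mem_resH_pullback mem_s fM cmu).
by rewrite triv //; case: coc => _ om1 _; have [-> ->] := om1 b sb.
Qed.
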